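(* There exists an absolute constant $A>0$ such that for every $f\in\mathcal M_-$, every $p\ge2$ and every $c$ with $1\le c\le p$, $$\|f^*_+\|_p\le A\left(c\|d^*_+\|_p+\sqrt c\,e^{p/c}\|s_2\|_p\right).$$
   Context: $\mathcal M_-$ is the set of all real-valued supermartingales $f=(f_0,f_1,\ldots)$ (integrable, with $f_0\equiv0$) on some probability space with respect to some filtration $(F_0,F_1,\ldots)$ (both may depend on $f$). Put $d_0=0$, $d_j=f_j-f_{j-1}$ for $j\ge1$, $f^*_+=\sup_{j\ge0}f_j$, $d^*_+=\sup_{j\ge0}d_j$, $s_2=\left(\sum_{j=1}^\infty\mathbf E_{j-1}d_j^2\right)^{1/2}$, where $\mathbf E_{j-1}$ is the conditional expectation given $F_{j-1}$. For a random variable $Y$, $\|Y\|_p=(\mathbf E|Y|^p)^{1/p}\in[0,\infty]$. *)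

(* Defs.v *)
From HB Require Import structures.
From mathcomp Require Import all_boot all_order all_algebra.
From mathcomp Require Import all_classical all_reals all_analysis.
From mathcomp Require Import measurable_realfun.

Set Implicit Arguments.
Unset Strict Implicit.
Unset Printing Implicit Defensive.

Import Order.TTheory GRing.Theory Num.Theory.
Import numFieldNormedType.Exports.

Local Open Scope classical_set_scope.
Local Open Scope ring_scope.

Definition is_filtration d (T : measurableType d) (F : nat -> set (set T)) :=
  [/\ forall n, sigma_algebra [set: T] (F n),
      forall n, F n `<=` measurable &
      forall n, F n `<=` F n.+1].

(* Y is a version of E[X | G].  The measurable sets of [g_sigma_algebraType G]
   are <<s G >>, that is, G itself when G is a sigma-algebra.  X is meant to be
   either integrable or nonnegative; the equations then force Y to be
   integrable in the first case, and almost surely nonnegative (possibly +oo)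
   in the second one. *)
Definition is_cond_exp (R : realType) d (T : measurableType d)
    (P : probability T R) (G : set (set T)) (X Y : T -> \bar R) :=
  measurable_fun [set: g_sigma_algebraType G]
    (Y : g_sigma_algebraType G -> \bar R) /\
  forall A, G A -> (\int[P]_(x in A) Y x = \int[P]_(x in A) X x)%E.

(* The last clause is E[f_(n+1) | F_n] <= f_n almost surely; it does not depend
   on the version Y, since two versions agree almost surely. *)
Definition is_supermartingale (R : realType) d (T : measurableType d)
    (P : probability T R) (F : nat -> set (set T)) (f : nat -> T -> R) :=
  [/\ is_filtration F,
      forall n, measurable_fun [set: g_sigma_algebraType (F n)]
        (f n : g_sigma_algebraType (F n) -> R),
      forall n, P.-integrable [set: T] (EFin \o f n) &
      forall n, exists2 Y, is_cond_exp P (F n) (EFin \o f n.+1) Y &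
        {ae P, forall x, (Y x <= (f n x)%:E)%E}].

Definition diff_seq (R : realType) (T : Type) (f : nat -> T -> R) (j : nat)
    (x : T) : R :=
  if j is k.+1 then f k.+1 x - f k x else 0.

Definition sup_seq (R : realType) (T : Type) (f : nat -> T -> R) (x : T)
    : \bar R :=
  ereal_sup (range (fun j => (f j x)%:E)).

(* V j stands for (a version of) E_j d_(j+1)^2, so that [sq_fun2 V] is s_2:
   indices are shifted by one with respect to sum_(j >= 1) E_(j-1) d_j^2. *)
Definition is_cond_var (R : realType) d (T : measurableType d)
    (P : probability T R) (F : nat -> set (set T)) (f : nat -> T -> R)
    (V : nat -> T -> \bar R) :=
  forall j, is_cond_exp P (F j) (fun x => (diff_seq f j.+1 x ^+ 2)%:E) (V j).

Definition sq_fun2 (R : realType) (T : Type) (V : nat -> T -> \bar R) (x : T)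
    : \bar R :=
  sqrte (\sum_(0 <= j <oo) V j x)%E.

(* Main.v *)
Require Import Defs.
From HB Require Import structures.
From mathcomp Require Import all_boot all_order all_algebra.
From mathcomp Require Import all_classical all_reals all_analysis.
From mathcomp Require Import measurable_realfun.
From mathcomp Require Import ring lra.

Set Implicit Arguments.
Unset Strict Implicit.
Unset Printing Implicit Defensive.

Import Order.TTheory GRing.Theory Num.Theory.
Import numFieldNormedType.Exports.

Local Open Scope classical_set_scope.
Local Open Scope ring_scope.

(** The proof is a good-lambda argument.  Write [M] for the maximal function
    [sup_seq f], [D] for [sup_seq (diff_seq f)] and [s] for [sq_fun2 V].  The
    heart of the matter is the inequality, for every level [l > 0],

      P(M > 2 l) <= e^(-2p) P(M > l) + P(6 c D > l) + P(K s > l)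

    with [K = 6 sqrt(c) e^(1/2 + p/c)] ([tail_good_lambda]).  Since
    [2^p e^(-2p) <= 1/2], integrating it against [d(l^p)] absorbs the first
    term on the right and leaves
    E M^p <= 2 2^p (E (6 c D)^p + E (K s)^p), where the absorption is legitimate
    because it is done on the truncations of [M] ([good_lambda],
    [moment_sup_le]).  Taking p-th roots gives the theorem with the constant 48.

    The level inequality is an exponential estimate of Bennett type, localized
    between the levels [l] and [2 l].  Only the increments that occur while the
    running maximum lies in ]l, 2 l] are kept; their sum is still a
    supermartingale, it vanishes as long as the maximum has not passed [l], and
    it is at least [l - a] once the maximum has passed [2 l], provided that no
    increment exceeds [a] ([crossing_gain]): [f] overshoots [l] by at most [a].
    Truncating the increments at [a] and subtracting [k = h^2 e^(h a)] times
    the conditional variances yields an exponential [Y] with E Y <= 1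
    ([exp_step], [exp_supermartingale]), because
    e^t <= 1 + t + t^2 e^b for t <= b ([expR_le_quad]).  As [Y = 1] on the event
    {M <= l}, the bound E Y <= 1 means that the part of E Y carried by
    {M > l} is at most P(M > l).  On {M > 2 l}, when [6 c D <= l] and
    [K s <= l], [Y] is at least [e^(2p)], and Markov's inequality produces the
    term e^(-2p) P(M > l) ([tail_run_max] for the running maxima, then
    [tail_sup_seq] by monotone limits).

    Both the one-step estimate, where a bound on the integrals over the sets of
    a sigma-algebra has to be upgraded to a bound with a measurable weight, and
    the integration over [l] rest on the same weighted layer cake formula
    ([layer_cake]).  Finally, the conditional variances are only almost surely
    nonnegative, and are replaced by their positive parts
    ([cond_exp_ge0_version]). *)

(** * The layer cake formula *)

Section LayerCake.
Context d (T : measurableType d) (R : realType).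
Local Open Scope ereal_scope.

Lemma integral_itv0_lt (u : \bar R) : 0 <= u ->
  \int[lebesgue_measure]_(t in `]0%R, +oo[)
    (\1_[set s : R | (s%:E < u)%E] t)%:E = u.
Proof.
move=> u0.
have mA : measurable [set s : R | s%:E < u].
  rewrite -[X in measurable X]setTI.
  by apply: (measurable_lte (T := measurableTypeR R) measurableT
    (f := EFin) (g := cst u)).
rewrite integral_indic//=.
case: u u0 mA => [r||//] r0 mA.
- rewrite (_ : _ `&` _ = `]0%R, r[%classic); last first.
    by apply/seteqP; split => x /=; rewrite !in_itv/= andbT lte_fin;
      [move=> [-> ->]|move=> /andP[]].
  rewrite [LHS]lebesgue_measure_itv/= !lte_fin.
  rewrite lee_fin le_eqVlt in r0.
  by case/orP: r0 => [/eqP <-|->]; rewrite ?ltxx// EFinN sube0.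
- rewrite (_ : _ `&` _ = `]0%R, +oo[%classic); last first.
    by apply/seteqP; split => x /=; rewrite !in_itv/= andbT ?ltry; move=> // -[].
  by rewrite [LHS]lebesgue_measure_itv/= ltry.
Qed.

Lemma measurable_undergraph (U : T -> \bar R) : measurable_fun setT U ->
  measurable_fun [set: T * measurableTypeR R]
    (fun z => (\1_[set y : T * measurableTypeR R | ((y.2)%:E < U y.1)%E] z : R)%:E).
Proof.
move=> mU; apply/measurable_EFinP/measurable_indic.
rewrite -[X in measurable X]setTI.
by apply: (measurable_lte measurableT (f := fun y => y.2%:E)
  (g := fun y => U y.1)); apply: measurableT_comp.
Qed.

Variable P : {sigma_finite_measure set T -> \bar R}.

Lemma tail_integralE (U X : T -> \bar R) (t : R) :
  \int[P]_(x in [set x | t%:E < U x]) X x =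
  \int[P]_x ((\1_[set y : T * measurableTypeR R | ((y.2)%:E < U y.1)%E] (x, t))%:E
     * X x).
Proof.
rewrite integral_mkcond; apply: eq_integral => x _; rewrite patchE indicE/=.
rewrite (_ : (x, t) \in _ = (x \in [set x0 | t%:E < U x0])); last first.
  by apply/idP/idP; rewrite !inE.
by case: ifPn; rewrite ?mul1e ?mul0e.
Qed.

Lemma measurable_tail_integral (U X : T -> \bar R) :
  measurable_fun setT U -> measurable_fun setT X -> (forall x, 0 <= X x) ->
  measurable_fun [set: measurableTypeR R]
    (fun t : R => \int[P]_(x in [set x | t%:E < U x]) X x).
Proof.
move=> mU mX X0; under eq_fun do rewrite tail_integralE.
apply: (measurable_fun_fubini_tonelli_G (fun z : T * measurableTypeR R =>
  (\1_[set y : T * measurableTypeR R | ((y.2)%:E < U y.1)%E] z)%:E * X z.1)).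
- apply: emeasurable_funM; first exact: measurable_undergraph.
  exact: measurableT_comp.
- by move=> z; rewrite mule_ge0// lee_fin.
Qed.

(** Tonelli's theorem for the region under the graph of [U]: each value [U x] is
    the length of the set of the levels below it. *)
Lemma layer_cake (U X : T -> \bar R) :
  measurable_fun setT U -> measurable_fun setT X ->
  (forall x, 0 <= U x) -> (forall x, 0 <= X x) ->
  \int[P]_x (U x * X x) =
  \int[lebesgue_measure]_(t in `]0%R, +oo[)
    \int[P]_(x in [set x | t%:E < U x]) X x.
Proof.
move=> mU mX U0 X0.
pose h (z : T * measurableTypeR R) : \bar R :=
  (\1_(`]0%R, +oo[%classic : set R) z.2)%:E *
  (\1_[set y : T * measurableTypeR R | ((y.2)%:E < U y.1)%E] z)%:E.
have mh : measurable_fun setT h.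
  apply: emeasurable_funM; last exact: measurable_undergraph.
  apply/measurable_EFinP.
  have mI : measurable_fun [set: measurableTypeR R]
      (\1_(`]0%R, +oo[%classic : set R) : R -> R).
    by apply: measurable_indic; exact: measurable_itv.
  exact: (measurableT_comp mI (@measurable_snd _ _ T (measurableTypeR R))).
pose g z := h z * X z.1.
have mg : measurable_fun setT g.
  by apply: emeasurable_funM => //; exact: measurableT_comp.
have g0 z : 0 <= g z by rewrite /g /h !mule_ge0// lee_fin.
transitivity (\int[P]_x \int[lebesgue_measure]_t g (x, t)).
  apply: eq_integral => x _.
  rewrite -{1}(integral_itv0_lt (U0 x)) integral_mkcond.
  rewrite /g/= ge0_integralZr//; last 2 first.
  - exact: (measurableT_comp mh (pair1_measurable x)).
  - by move=> t _; rewrite /h mule_ge0// lee_fin.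
  congr (_ * _); apply: eq_integral => t _.
  rewrite /h patchE [X in _ = X%:E * _]indicE/=.
  by case: ifPn => //= _; rewrite ?mul0e ?mul1e.
rewrite (fubini_tonelli g)//= [RHS]integral_mkcond.
apply: eq_integral => t _; rewrite patchE /g /h /=.
have -> : (\1_(`]0%R, +oo[%classic : set R) t)%:E =
    (t \in (`]0%R, +oo[%classic : set R))%:R%:E :> \bar R by rewrite indicE.
case: ifPn => _ /=; last by rewrite integral0_eq// => x _; rewrite !mul0e.
by rewrite tail_integralE; apply: eq_integral => x _; rewrite mul1e.
Qed.

End LayerCake.

(** * Consequences for probability measures *)

Section Weights.
Context d (T : measurableType d) (R : realType) (P : probability T R).
Local Open Scope ereal_scope.

(** If [X] is dominated by [Y] in mean on every superlevel set of the weight, as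
    when the weight is measurable for a sigma-algebra on which the domination
    is known, it is dominated in weighted mean: this replaces the rule that
    known factors come out of a conditional expectation. *)
Lemma le_integral_weight (U X Y : T -> \bar R) :
  measurable_fun setT U -> measurable_fun setT X -> measurable_fun setT Y ->
  (forall x, 0 <= U x) -> (forall x, 0 <= X x) -> (forall x, 0 <= Y x) ->
  (forall t : R, \int[P]_(x in [set x | t%:E < U x]) X x <=
                 \int[P]_(x in [set x | t%:E < U x]) Y x) ->
  \int[P]_x (U x * X x) <= \int[P]_x (U x * Y x).
Proof.
move=> mU mX mY U0 X0 Y0 XY; rewrite !layer_cake//.
apply: ge0_le_integral => //.
- by move=> t _; apply: integral_ge0 => x _.
- by apply: (@measurable_funTS _ _ (measurableTypeR R));
    exact: measurable_tail_integral.
- by apply: (@measurable_funTS _ _ (measurableTypeR R));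
    exact: measurable_tail_integral.
Qed.

Lemma layer_cake_prob (U : T -> \bar R) :
  measurable_fun setT U -> (forall x, 0 <= U x) ->
  \int[P]_x U x =
  \int[lebesgue_measure]_(t in `]0%R, +oo[) P [set x | t%:E < U x].
Proof.
move=> mU U0.
transitivity (\int[P]_x (U x * cst 1 x)).
  by apply: eq_integral => x _; rewrite mule1.
rewrite (layer_cake P (X := cst 1) mU)//.
apply: eq_integral => t _; rewrite integral_cst ?mul1e//.
by rewrite -[X in measurable X]setTI; apply: (measurable_lte measurableT
  (f := cst t%:E)).
Qed.

Lemma measurable_tail (U : T -> \bar R) : measurable_fun setT U ->
  measurable_fun [set: measurableTypeR R] (fun t : R => P [set x | t%:E < U x]).
Proof.
move=> mU.
apply: (eq_measurable_fun (fun t : R => \int[P]_(x in [set x | t%:E < U x]) cst 1 x)).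
  move=> t _; rewrite integral_cst ?mul1e//.
  by rewrite -[X in measurable X]setTI; apply: (measurable_lte measurableT
    (f := cst t%:E)).
exact: measurable_tail_integral.
Qed.

End Weights.

(** * The good-lambda principle *)

Section GoodLambda.
Context d (T : measurableType d) (R : realType) (P : probability T R).
Local Open Scope ereal_scope.

(** Integrating the hypothesis over [t] gives
    E X / b <= e E X + E D + E S, in which [e <= 1 / (2 b)] lets E X be absorbed
    when it is finite.  Finiteness is obtained by working with [min X n], for
    which the hypothesis persists: if [b * t < n], then also [t < n], so the
    truncation changes neither of the two level sets of [X], and otherwise the
    set on the left becomes empty. *)
Lemma good_lambda (X D S : T -> \bar R) (b e : R) :
  measurable_fun setT X -> measurable_fun setT D -> measurable_fun setT S ->
  (forall x, 0 <= X x) -> (forall x, 0 <= D x) -> (forall x, 0 <= S x) ->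
  (1 <= b)%R -> (0 <= e)%R -> (b * e <= 2^-1)%R ->
  (forall t : R, (0 < t)%R -> P [set x | (b * t)%:E < X x] <=
    e%:E * P [set x | t%:E < X x] + P [set x | t%:E < D x] +
    P [set x | t%:E < S x]) ->
  \int[P]_x X x <= (2 * b)%:E * (\int[P]_x D x + \int[P]_x S x).
Proof.
move=> mX mD mS X0 D0 S0 b1 e0 be H.
have b0 : (0 < b)%R by apply: lt_le_trans b1.
pose XN n x := mine (X x) n%:R%:E.
have mXN n : measurable_fun setT (XN n) by apply: measurable_mine.
have XN0 n x : 0 <= XN n x by rewrite /XN le_min X0 lee_fin ler0n.
have key n : \int[P]_x XN n x <= (2 * b)%:E * (\int[P]_x D x + \int[P]_x S x).
  have I0 : 0 <= \int[P]_x XN n x by exact: integral_ge0.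
  have ID0 : 0 <= \int[P]_x D x by exact: integral_ge0.
  have IS0 : 0 <= \int[P]_x S x by exact: integral_ge0.
  have Ifin : \int[P]_x XN n x \is a fin_num.
    rewrite ge0_fin_numE//; apply: (@le_lt_trans _ _ (\int[P]_x cst n%:R%:E x)).
      apply: ge0_le_integral => //.
      by move=> x _; rewrite /XN ge_min lexx orbT.
    by rewrite integral_cst//= probability_setT mule1 ltry.
  have Hn t : (0 < t)%R -> P [set x | t%:E < (b^-1)%:E * XN n x] <=
      e%:E * P [set x | t%:E < XN n x] + P [set x | t%:E < D x] +
      P [set x | t%:E < S x].
    move=> t0; have [bn|nb] := ltP (b * t)%R n%:R; last first.
      rewrite [X in P X](_ : _ = set0); last first.
        apply/seteqP; split => x //=; rewrite lte_pdivlMl// -EFinM.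
        by rewrite ltNge /XN ge_min lee_fin nb orbT.
      by rewrite measure0 !adde_ge0// mule_ge0.
    have tn : (t < n%:R)%R by apply: le_lt_trans bn; rewrite ler_peMl// ltW.
    rewrite [X in P X](_ : _ = [set x | (b * t)%:E < X x]); last first.
      apply/seteqP; split => x /=; rewrite lte_pdivlMl// -EFinM lt_min.
        by case/andP.
      by move=> ->; rewrite lte_fin bn.
    rewrite [X in e%:E * P X](_ : _ = [set x | t%:E < X x]); first exact: H.
    apply/seteqP; split => x /=; rewrite lt_min; first by case/andP.
    by move=> ->; rewrite lte_fin tn.
  have le1 : (b^-1)%:E * \int[P]_x XN n x <=
      e%:E * \int[P]_x XN n x + \int[P]_x D x + \int[P]_x S x.
    have b'0 : (0 <= b^-1)%R by rewrite invr_ge0 ltW.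
    rewrite -ge0_integralZl//.
    have mb : measurable_fun setT (fun x => (b^-1)%:E * XN n x).
      exact: measurable_funeM.
    have bXN0 x : 0 <= (b^-1)%:E * XN n x by rewrite mule_ge0.
    rewrite (layer_cake_prob P mb bXN0) (layer_cake_prob P (mXN n) (XN0 n)).
    rewrite (layer_cake_prob P mD D0) (layer_cake_prob P mS S0).
    have tail (U : T -> \bar R) : measurable_fun setT U ->
        measurable_fun (`]0%R, +oo[%classic : set (measurableTypeR R))
          (fun t : R => P [set x | t%:E < U x]).
      by move=> mU; apply: (@measurable_funTS _ _ (measurableTypeR R));
        exact: measurable_tail.
    have mI : measurable (`]0%R, +oo[%classic : set (measurableTypeR R)).
      exact: measurable_itv.
    rewrite -ge0_integralZl//; last exact: tail.
    rewrite -ge0_integralD//; last 3 first.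
    - by move=> t _; rewrite mule_ge0.
    - by apply: measurable_funeM; exact: tail.
    - exact: tail.
    rewrite -ge0_integralD//; last 3 first.
    - by move=> t _; rewrite adde_ge0// mule_ge0.
    - by apply: emeasurable_funD; [apply: measurable_funeM|]; exact: tail.
    - exact: tail.
    apply: ge0_le_integral => //.
    - exact: tail.
    - apply: emeasurable_funD; last exact: tail.
      by apply: emeasurable_funD; [apply: measurable_funeM|]; exact: tail.
    - by move=> t /=; rewrite in_itv/= andbT => /Hn.
  move: le1; rewrite -addeA.
  have [DS|DS] := eqVneq (\int[P]_x D x + \int[P]_x S x) +oo.
    by rewrite DS gt0_muley ?leey// lte_fin mulr_gt0.
  have DSf : \int[P]_x D x + \int[P]_x S x \is a fin_num.
    by rewrite ge0_fin_numE; [rewrite ltey|exact: adde_ge0].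
  rewrite -(fineK Ifin) -(fineK DSf) -!EFinM -EFinD !lee_fin.
  have : (0 <= fine (\int[P]_x XN n x))%R by rewrite fine_ge0.
  set I := fine _; set C := fine _ => I00.
  rewrite ler_pdivrMl// => h.
  have : (b * e * I <= 2^-1 * I)%R by apply: ler_wpM2r.
  nra.
have cvgX : \int[P]_x XN n x @[n --> \oo] --> \int[P]_x X x.
  rewrite [X in _ --> X](_ : _ = \int[P]_x (limn (XN ^~ x))).
    apply: cvg_monotone_convergence => // x _ m n mn.
    by rewrite /XN le_min !ge_min lexx/= lee_fin ler_nat mn orbT.
  apply: eq_integral => x _; apply/esym/cvg_lim => //.
  rewrite /XN; case: (X x) (X0 x) => [r| |]// r0.
    apply: cvg_near_cst; near=> n; apply/eqP; rewrite eq_le ge_min lexx/=.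
    rewrite le_min lexx lee_fin/=; near: n; exact: nbhs_infty_ger.
  apply/cvgeyPge => A; near=> n.
  rewrite le_min leey lee_fin/=; near: n; exact: nbhs_infty_ger.
rewrite -(cvg_lim _ cvgX)//; apply: lime_le.
  by apply/cvg_ex; exists (\int[P]_x X x).
exact: nearW.
Unshelve. all: by end_near. Qed.

End GoodLambda.

(** * Measurability with respect to nested sigma-algebras *)

Section SubSigmaAlgebra.
Context d (T : measurableType d).

Lemma measurable_g_sigmaE (G : set (set T)) (A : set T) :
  sigma_algebra setT G ->
  (measurable (A : set (g_sigma_algebraType G))) = G A.
Proof. by move=> sG; rewrite -[in RHS](sigma_algebra_id sG). Qed.

Lemma measurable_fun_finer d' (T' : measurableType d') (G H : set (set T))
    (f : T -> T') :
  sigma_algebra setT G -> sigma_algebra setT H -> G `<=` H ->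
  measurable_fun [set: g_sigma_algebraType G] (f : g_sigma_algebraType G -> T') ->
  measurable_fun [set: g_sigma_algebraType H] (f : g_sigma_algebraType H -> T').
Proof.
move=> sG sH GH mf _ Y mY; rewrite measurable_g_sigmaE//; apply: GH.
by have := mf measurableT Y mY; rewrite measurable_g_sigmaE.
Qed.

Lemma measurable_fun_ambient d' (T' : measurableType d') (G : set (set T))
    (f : T -> T') :
  sigma_algebra setT G -> G `<=` measurable ->
  measurable_fun [set: g_sigma_algebraType G] (f : g_sigma_algebraType G -> T') ->
  measurable_fun [set: T] f.
Proof.
move=> sG GT mf _ Y mY; apply: GT.
by have := mf measurableT Y mY; rewrite measurable_g_sigmaE.
Qed.

End SubSigmaAlgebra.

(** * One step of the exponential supermartingale *)

Section ExponentialStep.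
Context (R : realType).

(** Everything follows from [e^t (1 - t) <= 1]: multiplied by [1 + t] it bounds
    [e^t] by [1 + t + t^2 e^t] for [t >= 0], and for [t < 0] it reduces the claim
    to [1 <= (1 - t) (1 + t + t^2) = 1 - t^3]. *)
Lemma expR_le_quad (t b : R) : t <= b -> 0 <= b ->
  expR t <= 1 + t + t ^+ 2 * expR b.
Proof.
move=> tb b0; have e0 : 0 < expR t := expR_gt0 t.
have h1 : expR t * (1 - t) <= 1.
  have et : expR t * expR (- t) = 1 by rewrite -expRD subrr expR0.
  by rewrite -[leRHS]et ler_pM2l// expR_ge1Dx.
have [t0|t0] := leP 0 t.
  have e1 : t ^+ 2 * expR t <= t ^+ 2 * expR b.
    by rewrite ler_wpM2l ?sqr_ge0// ler_expR.
  have : (1 + t) * (expR t * (1 - t)) <= (1 + t) * 1 by rewrite ler_wpM2l//; lra.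
  lra.
have eb : t ^+ 2 * 1 <= t ^+ 2 * expR b.
  by rewrite ler_wpM2l ?sqr_ge0// -[1]expR0 ler_expR.
have h2 : expR t <= 1 + t + t ^+ 2.
  rewrite -(ler_pM2r (x := 1 - t)); last lra.
  nra.
lra.
Qed.

(** Only the large values are cut off: for [0 <= a] this lowers an increment, and
    so keeps its conditional mean nonpositive. *)
Definition trunc (a x : R) : R := if x <= a then x else 0.

Context d (T : measurableType d) (P : probability T R) (G : set (set T)).
Hypothesis sG : sigma_algebra setT G.
Hypothesis GT : G `<=` measurable.
Local Open Scope ereal_scope.

(** With [k = h^2 e^(h a)], the quadratic bound on the exponential shows that the
    conditional expectation of [exp (h * trunc a xi)] is at most [1 + k v], which
    the factor [exp (- k v)] more than compensates. *)
Lemma exp_step (xi v W : T -> R) (h a : R) :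
  P.-integrable setT (EFin \o xi) ->
  measurable_fun [set: g_sigma_algebraType G] (v : g_sigma_algebraType G -> R) ->
  measurable_fun [set: g_sigma_algebraType G] (W : g_sigma_algebraType G -> R) ->
  (forall x, 0 <= v x)%R -> (forall x, 0 <= W x)%R ->
  (forall A, G A -> \int[P]_(x in A) (xi x)%:E <= 0) ->
  (forall A, G A -> \int[P]_(x in A) (v x)%:E = \int[P]_(x in A) (xi x ^+ 2)%:E) ->
  (0 <= h)%R -> (0 <= a)%R ->
  \int[P]_x (W x * expR (h * trunc a (xi x) - h ^+ 2 * expR (h * a) * v x))%:E <=
  \int[P]_x (W x)%:E.
Proof.
move=> ixi mvG mWG v0 W0 xi0 xi2 h0 a0; set k := (h ^+ 2 * expR (h * a))%R.
have k0 : (0 <= k)%R by rewrite mulr_ge0// ?sqr_ge0// expR_ge0.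
have mv := measurable_fun_ambient sG GT mvG.
have mW := measurable_fun_ambient sG GT mWG.
have mxi : measurable_fun setT xi.
  by apply/measurable_EFinP; case/integrableP: ixi.
have mtr : measurable_fun setT (fun x => trunc a (xi x)).
  by apply: measurable_fun_ifT => //; exact: measurable_fun_ler.
pose X x := expR (h * trunc a (xi x)).
have mX : measurable_fun setT X.
  by apply: (measurableT_comp (@measurable_expR R)); exact: measurable_funM.
have step A : G A ->
    \int[P]_(x in A) (X x)%:E <= \int[P]_(x in A) (1 + k * v x)%:E.
  move=> GA; have mA := GT GA.
  have iA : P.-integrable A (EFin \o xi) by apply: integrableS ixi.
  (* The positive and negative parts of xi stand on opposite sides so that all
     integrals below are those of nonnegative functions: xi ^+ 2 need not be
     integrable. *)
  have ineq x : ((X x)%:E + h%:E * (EFin \o xi)^\- x <=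
      1 + h%:E * (EFin \o xi)^\+ x + k%:E * (xi x ^+ 2)%:E)%E.
    rewrite funeposE funenegE /= -!EFin_max -!EFinM -!EFinD lee_fin /X.
    set D := trunc a (xi x).
    have Da : (D <= a)%R by rewrite /D /trunc; case: ifP.
    have Dx : (D <= xi x)%R.
      by rewrite /D /trunc; case: ifPn => //; rewrite -ltNge => /ltW; apply: le_trans.
    have D2 : (D ^+ 2 <= xi x ^+ 2)%R.
      by rewrite /D /trunc; case: ifPn => // _; rewrite expr0n/= sqr_ge0.
    have := expR_le_quad (ler_wpM2l h0 Da) (mulr_ge0 h0 a0).
    have : (h * D <= h * xi x)%R by exact: ler_wpM2l.
    have : (k * D ^+ 2 <= k * xi x ^+ 2)%R by exact: ler_wpM2l.
    have : (h * xi x = h * Num.max (xi x) 0 - h * Num.max (- xi x) 0)%R.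
      by rewrite -mulrBr; congr *%R; rewrite /Num.max; do 2 case: ltP => ?; lra.
    rewrite exprMn /k; set e := expR (h * a); lra.
  have mp : measurable_fun A (EFin \o xi)^\+.
    by apply: measurable_funTS; apply: measurable_funepos; exact/measurable_EFinP.
  have mn : measurable_fun A (EFin \o xi)^\-.
    by apply: measurable_funTS; apply: measurable_funeneg; exact/measurable_EFinP.
  have mX' : measurable_fun A (fun x => (X x)%:E).
    by apply: measurable_funTS; exact/measurable_EFinP.
  have mxi2 : measurable_fun A (fun x => (xi x ^+ 2)%:E).
    by apply: measurable_funTS; apply/measurable_EFinP; exact: measurable_funX.
  have mv' : measurable_fun A (fun x => (v x)%:E).
    by apply: measurable_funTS; exact/measurable_EFinP.
  have mhp : measurable_fun A (fun x => h%:E * (EFin \o xi)^\+ x).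
    exact: measurable_funeM.
  have mhn : measurable_fun A (fun x => h%:E * (EFin \o xi)^\- x).
    exact: measurable_funeM.
  have mkxi2 : measurable_fun A (fun x => k%:E * (xi x ^+ 2)%:E).
    exact: measurable_funeM.
  have hp0 x : 0 <= h%:E * (EFin \o xi)^\+ x by rewrite mule_ge0.
  have hn0 x : 0 <= h%:E * (EFin \o xi)^\- x by rewrite mule_ge0.
  have xi20 x : 0 <= (xi x ^+ 2)%:E :> \bar R by rewrite lee_fin sqr_ge0.
  have kxi20 x : 0 <= k%:E * (xi x ^+ 2)%:E by rewrite mule_ge0.
  have X0 x : 0 <= (X x)%:E by rewrite lee_fin expR_ge0.
  have posneg : \int[P]_(x in A) (EFin \o xi)^\+ x <=
      \int[P]_(x in A) (EFin \o xi)^\- x.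
    by rewrite -sube_le0; have := xi0 A GA; rewrite integralE.
  have : \int[P]_(x in A) ((X x)%:E + h%:E * (EFin \o xi)^\- x) <=
      \int[P]_(x in A) (1 + h%:E * (EFin \o xi)^\+ x + k%:E * (xi x ^+ 2)%:E).
    apply: ge0_le_integral => //.
    - by move=> x _; rewrite adde_ge0.
    - exact: emeasurable_funD.
    - by apply: emeasurable_funD => //; exact: emeasurable_funD.
  rewrite ge0_integralD// ge0_integralD//; last 2 first.
  - by move=> x _; rewrite adde_ge0.
  - exact: emeasurable_funD.
  rewrite ge0_integralD// !ge0_integralZl// -xi2//.
  rewrite [X in _ -> _ <= X](_ : _ =
    \int[P]_(x in A) 1 + k%:E * \int[P]_(x in A) (v x)%:E); last first.
    rewrite -ge0_integralZl//; last by move=> x _; rewrite lee_fin.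
    by rewrite -ge0_integralD//; [move=> x _; rewrite mule_ge0// lee_fin
      |exact: measurable_funeM].
  move=> hh.
  have hnf : h%:E * \int[P]_(x in A) (EFin \o xi)^\- x \is a fin_num.
    by rewrite fin_numM//; exact: integrable_neg_fin_num.
  rewrite -(leeD2rE _ _ hnf); apply: (le_trans hh).
  rewrite addeAC; apply: leeD2l.
  exact: lee_wpmul2l.
pose U x := (W x * expR (- (k * v x)))%R.
have mUG : measurable_fun [set: g_sigma_algebraType G] (U : g_sigma_algebraType G -> R).
  apply: measurable_funM => //; apply: (measurableT_comp (@measurable_expR R)).
  by apply: measurableT_comp => //; exact: measurable_funM.
have mU := measurable_fun_ambient sG GT mUG.
have U0 x : (0 <= U x)%R by rewrite mulr_ge0// expR_ge0.
have mY : measurable_fun setT (fun x => 1 + k * v x)%R.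
  by apply: measurable_funD => //; exact: measurable_funM.
have Y0 x : (0 <= 1 + k * v x)%R by rewrite addr_ge0// mulr_ge0.
apply: (@le_trans _ _ (\int[P]_x ((U x)%:E * (X x)%:E))).
  apply: ge0_le_integral => //.
  - by move=> x _; rewrite lee_fin mulr_ge0// expR_ge0.
  - apply/measurable_EFinP; apply: measurable_funM => //.
    apply: (measurableT_comp (@measurable_expR R)).
    by apply: measurable_funB; exact: measurable_funM.
  - by apply: emeasurable_funM; exact/measurable_EFinP.
  - by move=> x _; rewrite -EFinM lee_fin /U /X -[leRHS]mulrA -expRD addrC.
apply: (@le_trans _ _ (\int[P]_x ((U x)%:E * (1 + k * v x)%:E))).
  apply: (@le_integral_weight _ _ _ _ (fun x => (U x)%:E) (fun x => (X x)%:E)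
    (fun x => (1 + k * v x)%:E)) => //; try exact/measurable_EFinP.
    by move=> x; rewrite lee_fin expR_ge0.
  move=> t; apply: step.
  rewrite -measurable_g_sigmaE// -[X in measurable X]setTI.
  by apply: (measurable_lte measurableT (f := cst t%:E)) => //; exact/measurable_EFinP.
apply: ge0_le_integral => //.
- by move=> x _; rewrite mule_ge0// lee_fin.
- by apply: emeasurable_funM; exact/measurable_EFinP.
- exact/measurable_EFinP.
- move=> x _; rewrite -EFinM lee_fin /U -[leLHS]mulrA ler_piMr//.
  have et : (expR (- (k * v x)) * expR (k * v x) = 1)%R.
    by rewrite -expRD addNr expR0.
  by rewrite -[leRHS]et ler_pM2l ?expR_gt0// expR_ge1Dx.
Qed.

End ExponentialStep.

(** * The exponential supermartingale *)

Section ExponentialSupermartingale.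
Context (R : realType) d (T : measurableType d) (P : probability T R).
Local Open Scope ereal_scope.

Lemma exp_supermartingale (F : nat -> set (set T)) (xi v : nat -> T -> R)
    (h a : R) :
  is_filtration F ->
  (forall j, P.-integrable setT (EFin \o xi j)) ->
  (forall j, measurable_fun [set: g_sigma_algebraType (F j.+1)]
    (xi j : g_sigma_algebraType (F j.+1) -> R)) ->
  (forall j, measurable_fun [set: g_sigma_algebraType (F j)]
    (v j : g_sigma_algebraType (F j) -> R)) ->
  (forall j x, 0 <= v j x)%R ->
  (forall j A, F j A -> \int[P]_(x in A) (xi j x)%:E <= 0) ->
  (forall j A, F j A ->
    \int[P]_(x in A) (v j x)%:E = \int[P]_(x in A) (xi j x ^+ 2)%:E) ->
  (0 <= h)%R -> (0 <= a)%R ->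
  forall n, \int[P]_x (expR (\sum_(j < n)
    (h * trunc a (xi j x) - h ^+ 2 * expR (h * a) * v j x)))%:E <= 1.
Proof.
move=> [sF FT Fn] ixi mxi mv v0 xi0 xi2 h0 a0.
pose L n x := (\sum_(j < n)
    (h * trunc a (xi j x) - h ^+ 2 * expR (h * a) * v j x))%R.
have mL n : measurable_fun [set: g_sigma_algebraType (F n)]
    (L n : g_sigma_algebraType (F n) -> R).
  elim: n => [|n ih].
    by rewrite (_ : L 0%N = cst 0%R)//; apply/funext => x; rewrite /L big_ord0.
  rewrite (_ : L n.+1 = (fun x => L n x + (h * trunc a (xi n x) -
      h ^+ 2 * expR (h * a) * v n x))%R); last first.
    by apply/funext => x; rewrite /L big_ord_recr.
  apply: measurable_funD.
    by apply: (measurable_fun_finer (sF n) (sF n.+1) (Fn n)).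
  apply: measurable_funB; apply: measurable_funM => //.
    by apply: measurable_fun_ifT => //; exact: measurable_fun_ler.
  by apply: (measurable_fun_finer (sF n) (sF n.+1) (Fn n)).
elim=> [|n ih].
  under eq_integral do rewrite big_ord0 expR0.
  by rewrite integral_cst//= probability_setT mule1.
apply: le_trans ih.
under eq_integral do rewrite big_ord_recr/= expRD.
apply: (@exp_step _ _ _ P (F n) (sF n) (FT n) (xi n) (v n) 
  (fun x => expR (L n x)) h a) => //.
- exact: (measurableT_comp (@measurable_expR R)).
- exact: xi0.
- exact: xi2.
Qed.

Lemma integral_if (A : set T) (B : T -> bool) (g : T -> R) :
  \int[P]_(x in A) (if B x then g x else 0)%R%:E =
  \int[P]_(x in A `&` [set x | B x]) (g x)%:E.
Proof.
rewrite integral_mkcondr; apply: eq_integral => x _; rewrite patchE.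
by rewrite mem_setE /in_mem/=; case: (B x).
Qed.

End ExponentialSupermartingale.

(** * Crossing a level band: the pathwise estimate *)

Section Paths.
Context (R : realType).

Fixpoint run_max (f : nat -> R) (n : nat) : R :=
  if n is m.+1 then Num.max (run_max f m) (f n) else f 0%N.

Lemma run_max_ge (f : nat -> R) (n j : nat) : (j <= n)%N -> f j <= run_max f n.
Proof.
elim: n j => [|n ih] j /=; first by rewrite leqn0 => /eqP ->.
rewrite leq_eqVlt ltnS le_max => /orP[/eqP ->|/ih ->//].
by rewrite lexx orbT.
Qed.

Lemma run_max_nd (f : nat -> R) (m n : nat) :
  (m <= n)%N -> run_max f m <= run_max f n.
Proof.
move=> /subnK <-; elim: (n - m)%N => [|k ih]//.
by rewrite addSn /= le_max ih.
Qed.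

Lemma run_maxP (f : nat -> R) (n : nat) :
  exists2 j, (j <= n)%N & run_max f n = f j.
Proof.
elim: n => [|n [j jn e]]; first by exists 0%N.
rewrite /= /Num.max; case: ifPn => _; first by exists n.+1.
by exists j => //; exact: leqW.
Qed.

Definition crossing (l : R) (f : nat -> R) (j : nat) : bool :=
  (l < run_max f j) && (run_max f j <= 2 * l).

(** The first value above [l] is at most [l + a], since the path was at most [l]
    just before; as [l + a <= 2 * l], the band cannot be jumped over, and the
    increments collected inside it add up to the climb from that value. *)
Lemma crossing_gain (l a : R) (f : nat -> R) (n : nat) :
  0 < l -> a <= l -> f 0%N = 0 -> (forall j, f j.+1 - f j <= a) ->
  let S := \sum_(j < n) (if crossing l f j then f j.+1 - f j else 0) in
  [/\ run_max f n <= l -> S = 0,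
      crossing l f n -> f n - l - a <= S &
      2 * l < run_max f n -> l - a <= S].
Proof.
move=> l0 al f0 fa /=; elim: n => [|n [ih1 ih2 ih3]].
  rewrite big_ord0 /crossing /= f0; split => //.
    by case/andP => l1; lra.
  lra.
have fM : f n <= run_max f n by exact: run_max_ge.
rewrite big_ord_recr/=; have fan := fa n.
move: ih1 ih2 ih3; rewrite /crossing /=.
set M := run_max f n in fM *; set S := \sum_(_ < _) _ => ih1 ih2 ih3.
have [Ml|lM] := leP M l.
  have S0 : S = 0 by exact: ih1.
  rewrite S0 /= add0r; split => //.
    case/andP => _ _; lra.
  by rewrite lt_max => /orP[]; lra.
have [M2|M2] /= := leP M (2 * l).
  have := ih2; rewrite -/M lM M2 => /(_ isT) h; split.
  - by rewrite ge_max => /andP[]; lra.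
  - by move=> _; lra.
  - by rewrite lt_max => /orP[]; lra.
rewrite addr0; have h := ih3 M2; split => //.
- by rewrite ge_max => /andP[]; lra.
- by move=> /andP[_]; rewrite ge_max => /andP[]; lra.
Qed.

End Paths.

(** * Tail estimate for a supermartingale *)

Section Supermartingale.
Context (R : realType) d (T : measurableType d) (P : probability T R).
Local Open Scope ereal_scope.

(** Comparing positive and negative parts separately spares the integrability of
    [Y], which [is_cond_exp] provides only indirectly. *)
Lemma ae_le_integral (A : set T) (Y g : T -> \bar R) :
  measurable A -> measurable_fun A Y -> measurable_fun A g ->
  {ae P, forall x, Y x <= g x} ->
  \int[P]_(x in A) Y x <= \int[P]_(x in A) g x.
Proof.
move=> mA mY mg Yg; rewrite integralE [leRHS]integralE; apply: leeB.
- apply: ae_ge0_le_integral => //; try exact: measurable_funepos.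
  by apply: filterS Yg => x Yg _; rewrite !funeposE ge_max !le_max Yg lexx orbT.
- apply: ae_ge0_le_integral => //; try exact: measurable_funeneg.
  apply: filterS Yg => x Yg _.
  by rewrite !funenegE ge_max !le_max leeN2 Yg lexx orbT.
Qed.

Lemma measurable_sup_seq (g : nat -> T -> R) :
  (forall j, measurable_fun setT (g j)) -> measurable_fun setT (sup_seq g).
Proof.
move=> mg; rewrite (_ : sup_seq g = fun x => esups (fun j => (g j x)%:E) 0%N).
  by apply: measurable_fun_esups => j; exact/measurable_EFinP.
apply/funext => x; rewrite /esups /sup_seq /=; congr ereal_sup.
by apply/seteqP; split => y [j _ <-]; exists j.
Qed.

Lemma measurable_gt (g : T -> \bar R) (c : R) :
  measurable_fun setT g -> measurable [set x | c%:E < g x].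
Proof.
move=> mg; rewrite -[X in measurable X]setTI.
exact: (measurable_lte measurableT (f := cst c%:E)).
Qed.

Lemma sup_seq_gt (g : nat -> T -> R) (c : R) :
  [set x | c%:E < sup_seq g x] =
  \bigcup_n [set x | (c < run_max (g ^~ x) n)%R].
Proof.
apply/seteqP; split => x /=.
  move=> /ereal_sup_gt[_ [j _ <-]]; rewrite lte_fin => cg.
  by exists j => //=; apply: (lt_le_trans cg); exact: run_max_ge.
move=> [n _ /=]; have [j _ ->] := run_maxP (g ^~ x) n => cg.
apply: (@lt_le_trans _ _ (g j x)%:E); first by rewrite lte_fin.
by apply: ereal_sup_ubound; exists j.
Qed.

Variables (F : nat -> set (set T)) (f : nat -> T -> R).
Hypothesis sf : is_supermartingale P F f.

Let sF n : sigma_algebra setT (F n). Proof. by case: sf => -[]. Qed.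
Let FT n : F n `<=` measurable. Proof. by case: sf => -[]. Qed.
Let Fnd n : F n `<=` F n.+1. Proof. by case: sf => -[]. Qed.

Lemma diff_integrable n : P.-integrable setT (EFin \o diff_seq f n.+1).
Proof.
case: sf => _ _ fi _.
rewrite (_ : _ \o _ = (EFin \o f n.+1) \- (EFin \o f n)).
  exact: integrableB.
by apply/funext => x /=; rewrite EFinB.
Qed.

Lemma diff_integral_le0 n A : F n A ->
  \int[P]_(x in A) (diff_seq f n.+1 x)%:E <= 0.
Proof.
case: sf => _ mf fi /(_ n)[Y [mY YE] Yf] FA; have mA := FT FA.
under eq_integral do rewrite /= EFinB.
have fiA k : P.-integrable A (EFin \o f k) by apply: integrableS (fi k).
rewrite integralB//; try exact: fiA.
rewrite sube_le0; apply: (@le_trans _ _ (\int[P]_(x in A) Y x)).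
  by rewrite le_eqVlt; apply/orP; left; apply/eqP; exact/esym/(YE A FA).
apply: ae_le_integral => //.
- by apply: measurable_funTS; apply: measurable_fun_ambient mY.
- by case/integrableP: (fiA n).
Qed.

Lemma diff_adapted n : measurable_fun [set: g_sigma_algebraType (F n.+1)]
  (diff_seq f n.+1 : g_sigma_algebraType (F n.+1) -> R).
Proof.
case: sf => _ mf _ _; apply: measurable_funB; first exact: mf.
exact: (measurable_fun_finer (sF n) (sF n.+1) (@Fnd n)).
Qed.

Lemma run_max_adapted n : measurable_fun [set: g_sigma_algebraType (F n)]
  ((fun x => run_max (f ^~ x) n) : g_sigma_algebraType (F n) -> R).
Proof.
case: sf => _ mf _ _; elim: n => [|n ih] /=; first exact: mf.
apply: measurable_maxr; last exact: mf.
exact: (measurable_fun_finer (sF n) (sF n.+1) (@Fnd n)).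
Qed.

Variable V : nat -> T -> \bar R.
Hypothesis VE : is_cond_var P F f V.
Hypothesis V0 : forall j x, 0 <= V j x.
Hypothesis f0 : forall x, f 0%N x = 0%R.

Let mV j : measurable_fun setT (V j).
Proof. by have [mV _] := VE j; exact: (measurable_fun_ambient (sF _) (@FT _) mV). Qed.

Let mdiff j : measurable_fun setT (diff_seq f j.+1).
Proof. exact: (measurable_fun_ambient (sF _) (@FT _) (@diff_adapted j)). Qed.

Lemma measurable_var : measurable_fun setT (fun x => \sum_(0 <= j <oo) V j x).
Proof. by apply: ge0_emeasurable_sum. Qed.

Lemma measurable_sup : measurable_fun setT (sup_seq f).
Proof.
apply: measurable_sup_seq => n; case: sf => _ mf _ _.
exact: (measurable_fun_ambient (sF _) (@FT _) (mf n)).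
Qed.

Lemma measurable_sup_diff : measurable_fun setT (sup_seq (diff_seq f)).
Proof.
apply: measurable_sup_seq => -[|j]; last exact: mdiff.
by rewrite (_ : diff_seq f 0 = cst 0%R).
Qed.

Section Tail.
Variables (l a h y2 q : R).
Hypotheses (l0 : (0 < l)%R) (a0 : (0 <= a)%R) (al : (a <= l)%R) (h0 : (0 <= h)%R).

(** The activity of step [j] is decided at time [j], so that selecting the active
    increments is a martingale transform by 0 and 1.  Finiteness of the
    conditional variance is included to make [act_var] an honest version of the
    conditional variance of [act_diff]. *)
Definition active j x := crossing l (f ^~ x) j && (V j x < +oo).
Definition act_diff j x : R := if active j x then diff_seq f j.+1 x else 0%R.
Definition act_var j x : R := if active j x then fine (V j x) else 0%R.

Lemma active_adapted j : measurable_fun [set: g_sigma_algebraType (F j)]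
  (active j : g_sigma_algebraType (F j) -> bool).
Proof.
have mM := @run_max_adapted j; have [mVj _] := VE j.
apply: measurable_and; last exact: measurable_fun_lte.
by apply: measurable_and; [exact: measurable_fun_ltr|exact: measurable_fun_ler].
Qed.

Lemma exp_moment_active n : \int[P]_x (expR (\sum_(j < n)
  (h * trunc a (act_diff j x) - h ^+ 2 * expR (h * a) * act_var j x)))%:E <= 1.
Proof.
have mact j : F j [set x | active j x].
  rewrite -measurable_g_sigmaE// -[X in measurable X]setTI.
  exact: (@active_adapted j measurableT [set true]).
have FI j A : F j A -> F j (A `&` [set x | active j x]).
  move=> FA; rewrite -measurable_g_sigmaE//.
  by apply: measurableI; rewrite measurable_g_sigmaE.
apply: (exp_supermartingale (F := F)) => //.
- move=> j.
  rewrite (_ : _ \o _ = (EFin \o diff_seq f j.+1) \_ [set x | active j x]).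
    rewrite -integrable_mkcond; last exact: FT.
    by apply: integrableS (diff_integrable j) => //; exact: FT.
  apply/funext => x; rewrite patchE mem_setE /in_mem/= /act_diff.
  by rewrite /active; case: (_ && _).
- move=> j; apply: measurable_fun_ifT => //; last exact: diff_adapted.
  apply: (measurable_fun_finer (sF j) (sF j.+1) (@Fnd j)).
  exact: active_adapted.
- move=> j; apply: measurable_fun_ifT => //; first exact: active_adapted.
  by have [mVj _] := VE j; apply: measurableT_comp.
- by move=> j x; rewrite /act_var; case: ifP => // _; rewrite fine_ge0.
- by move=> j A FA; rewrite integral_if; apply: diff_integral_le0; exact: FI.
- move=> j A FA; rewrite integral_if.
  have [_ VEj] := VE j.
  transitivity (\int[P]_(x in A `&` [set x | active j x]) V j x).
    apply: eq_integral => x; rewrite inE /= => -[_ /andP[_ Vx]].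
    by rewrite fineK// ge0_fin_numE.
  rewrite VEj; last exact: FI.
  rewrite -integral_if; apply: eq_integral => x _; rewrite /act_diff.
  by case: ifP => //; rewrite expr0n.
Qed.

Hypothesis hq : (q <= h * (l - a) - h ^+ 2 * expR (h * a) * y2)%R.

(** When all increments are at most [a] and the variances sum to at most [y2],
    neither the truncation nor the finiteness clause of [active] interferes, and
    the exponent is bounded below by [crossing_gain]. *)
Lemma exponent_ge_active n x :
  (2 * l < run_max (f ^~ x) n)%R -> sup_seq (diff_seq f) x <= a%:E ->
  \sum_(0 <= j <oo) V j x <= y2%:E ->
  (q <= \sum_(j < n)
  (h * trunc a (act_diff j x) - h ^+ 2 * expR (h * a) * act_var j x))%R.
Proof.
move=> M2 da Vy.
have dja j : (diff_seq f j x <= a)%R.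
  by rewrite -lee_fin; apply: le_trans da; apply: ereal_sup_ubound; exists j.
have sumV k : \sum_(0 <= j < k) V j x <= y2%:E.
  by apply: le_trans Vy; exact: nneseries_lim_ge.
have Vfin j : V j x < +oo.
  apply: (@le_lt_trans _ _ y2%:E); last exact: ltry.
  by apply: le_trans (sumV j.+1); rewrite big_nat_recr//= leeDr// sume_ge0.
have act j : active j x = crossing l (f ^~ x) j by rewrite /active Vfin andbT.
rewrite sumrB -!mulr_sumr; apply: (le_trans hq).
apply: lerB.
  apply: ler_wpM2l => //.
  have [_ _ /(_ M2)] := crossing_gain n l0 al (f0 x) (fun j => dja j.+1).
  move=> /le_trans; apply; rewrite le_eqVlt; apply/orP; left; apply/eqP.
  apply: eq_bigr => j _; rewrite /act_diff act /trunc.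
  by case: ifP => _; rewrite ?a0 ?(dja j.+1 : f j.+1 x - f j x <= a)%R.
apply: ler_wpM2l; first by rewrite mulr_ge0 ?sqr_ge0 ?expR_ge0.
rewrite -lee_fin; apply: le_trans (sumV n); rewrite big_mkord -sumEFin.
apply: lee_sum => j _; rewrite /act_var.
by case: ifP => // _; rewrite fineK// ge0_fin_numE.
Qed.

Lemma exponent_eq0_inactive n x : (run_max (f ^~ x) n <= l)%R ->
  (\sum_(j < n)
  (h * trunc a (act_diff j x) - h ^+ 2 * expR (h * a) * act_var j x) = 0)%R.
Proof.
move=> Ml; apply: big1 => j _.
have : (run_max (f ^~ x) j <= l)%R.
  by apply: le_trans Ml; apply: run_max_nd; exact: ltnW.
rewrite /act_diff /act_var /active /crossing leNgt => /negbTE -> /=.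
by rewrite /trunc a0 !mulr0 subr0.
Qed.

Let mM n : measurable_fun setT (fun x => run_max (f ^~ x) n).
Proof. exact: (measurable_fun_ambient (sF _) (@FT _) (@run_max_adapted n)). Qed.

Let mMgt c n : measurable [set x | (c < run_max (f ^~ x) n)%R].
Proof.
by apply: (@measurable_gt (fun x => (run_max (f ^~ x) n)%:E)); exact/measurable_EFinP.
Qed.

(** The exponential has mean at most 1 and equals 1 on the complement of [B],
    hence has integral at most [P B] on [B], which contains the event [E] where
    it is at least [e^q]. *)
Lemma tail_run_max n :
  P [set x | (2 * l < run_max (f ^~ x) n)%R] <=
  (expR (- q))%:E * P [set x | (l < run_max (f ^~ x) n)%R] +
  P [set x | a%:E < sup_seq (diff_seq f) x] +
  P [set x | y2%:E < \sum_(0 <= j <oo) V j x].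
Proof.
set A := [set x | (2 * l < _)%R]; set B := [set x | (l < _)%R].
set C := [set x | a%:E < _]; set D := [set x | y2%:E < _].
have mA : measurable A by exact: mMgt.
have mB : measurable B by exact: mMgt.
have mC : measurable C by apply: measurable_gt; exact: measurable_sup_diff.
have mD : measurable D by apply: measurable_gt; exact: measurable_var.
pose E := A `\` (C `|` D).
have mE : measurable E by apply: measurableD => //; exact: measurableU.
have PE : P E <= (expR (- q))%:E * P B.
  have e1 : (expR q)%:E * P E + P (~` B) <= 1.
    apply: le_trans (exp_moment_active n).
    rewrite [X in X <= _](_ : _ = \int[P]_x ((expR q)%:E * (\1_E x)%:E +
        (\1_(~` B) x)%:E)); last first.
      have mI (K : set T) : measurable K ->
          measurable_fun setT (fun x => (\1_K x)%:E : \bar R).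
        by move=> mK; apply/measurable_EFinP; exact: measurable_indic.
      have mEI := mI E mE; have mBI := mI _ (measurableC mB).
      have I0 K x : 0 <= (\1_K x)%:E :> \bar R by rewrite lee_fin.
      have q0 : 0 <= (expR q)%:E by rewrite lee_fin expR_ge0.
      have qE0 x : 0 <= (expR q)%:E * (\1_E x)%:E by rewrite mule_ge0.
      have mqE : measurable_fun setT (fun x => (expR q)%:E * (\1_E x)%:E).
        exact: measurable_funeM.
      rewrite ge0_integralD// ge0_integralZl//.
      by rewrite !integral_indic ?setIT//; exact: measurableC.
    apply: ge0_le_integral => //.
    - by move=> x _; rewrite adde_ge0 ?lee_fin// mule_ge0// lee_fin expR_ge0.
    - apply/measurable_EFinP; apply: measurable_funD.
        by apply: measurable_funM => //; exact: measurable_indic.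
      by apply: measurable_indic; exact: measurableC.
    - apply/measurable_EFinP; apply: (measurableT_comp (@measurable_expR R)).
      apply: measurable_sum => j; have mact : measurable_fun setT (active j).
        exact: (measurable_fun_ambient (sF j) (@FT _) (@active_adapted j)).
      apply: measurable_funB; apply: measurable_funM => //.
        have mdj : measurable_fun setT (act_diff j) by exact: measurable_fun_ifT.
        by apply: measurable_fun_ifT => //; exact: measurable_fun_ler.
      by apply: measurable_fun_ifT => //; exact: measurableT_comp.
    move=> x _; rewrite -EFinM -EFinD lee_fin !indicE.
    have [lM|Ml] := ltP l (run_max (f ^~ x) n).
      rewrite (_ : x \in ~` B = false) ?addr0; last first.
        by apply/negbTE; rewrite notin_setE /setC /=; exact.
      have [xE|] := boolP (x \in E); last by rewrite mulr0 expR_ge0.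
      rewrite mulr1 ler_expR; move: xE; rewrite inE => -[Ax nCD].
      apply: exponent_ge_active => //; rewrite leNgt; apply/negP => ?; apply: nCD;
        by [left|right].
    rewrite exponent_eq0_inactive// expR0 (_ : x \in E = false); last first.
      apply/negbTE; rewrite notin_setE => -[/= Ax _]; move: Ax l0; rewrite /A /=; lra.
    by rewrite mulr0 add0r; case: (_ \in _).
  move: e1; rewrite probability_setC//.
  rewrite -(fineK (fin_num_measure P _ mE)) -(fineK (fin_num_measure P _ mB)).
  rewrite -EFinM -EFinB -EFinD -EFinM !lee_fin.
  set pE := fine _; set pB := fine _ => h1.
  by rewrite -(ler_pM2l (expR_gt0 q)) mulrA -expRD subrr expR0 mul1r; lra.
apply: (@le_trans _ _ (P (E `|` (C `|` D)))).
  apply: le_measure; rewrite ?inE//.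
    by apply: measurableU => //; exact: measurableU.
  by move=> x Ax; have [CDx|nCDx] := pselect ((C `|` D) x); [right|left].
apply: (le_trans (measureU2 _ mE (measurableU _ _ mC mD))).
by rewrite -addeA; apply: leeD => //; exact: measureU2.
Qed.

Lemma tail_sup_seq :
  P [set x | (2 * l)%:E < sup_seq f x] <=
  (expR (- q))%:E * P [set x | l%:E < sup_seq f x] +
  P [set x | a%:E < sup_seq (diff_seq f) x] +
  P [set x | y2%:E < \sum_(0 <= j <oo) V j x].
Proof.
have nd : {homo (fun n => [set x | (2 * l < run_max (f ^~ x) n)%R]) :
    m n / (m <= n)%N >-> (m <= n)%O}.
  move=> m n mn; apply/subsetPset => x /= /lt_le_trans; apply; exact: run_max_nd.
rewrite (sup_seq_gt f (2 * l)).
have mU c : measurable (\bigcup_n [set x | (c < run_max (f ^~ x) n)%R]).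
  exact: bigcup_measurable.
have cv : P [set x | (2 * l < run_max (f ^~ x) n)%R] @[n --> \oo] -->
    P (\bigcup_n [set x | (2 * l < run_max (f ^~ x) n)%R]).
  by apply: (nondecreasing_cvg_mu _ _ nd).
rewrite -(cvg_lim _ cv)//; apply: lime_le; first by apply/cvg_ex; eexists; exact: cv.
apply: nearW => n; apply: (le_trans (tail_run_max n)).
apply: leeD => //; apply: leeD => //; apply: lee_wpmul2l.
  by rewrite lee_fin expR_ge0.
rewrite sup_seq_gt; apply: le_measure; rewrite ?inE//.
by move=> x Mx; exists n.
Qed.

End Tail.
End Supermartingale.

(** * Nonnegative versions of conditional expectations *)

Section NonnegativeVersion.
Context (R : realType) d (T : measurableType d) (P : probability T R).
Local Open Scope ereal_scope.

(** The right-hand side is only the supremum of the integrals of the simple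
    functions below it, so that [f] may be an arbitrary function.  This is
    applied to the series of versions of conditional variances, whose terms
    may be negative on a null set, where the series may fail to converge. *)
Lemma ae_ge0_le_integral_right (g f : T -> \bar R) :
  measurable_fun setT g -> (forall x, 0 <= g x) -> (forall x, 0 <= f x) ->
  {ae P, forall x, g x <= f x} -> \int[P]_x g x <= \int[P]_x f x.
Proof.
move=> mg g0 f0 [N [mN PN gfN]].
have gN0 x : 0 <= (g \_ (~` N)) x by exact: erestrict_ge0.
apply: (@le_trans _ _ (\int[P]_x (g \_ (~` N)) x)).
  rewrite le_eqVlt; apply/orP; left; apply/eqP; apply: ae_eq_integral => //.
    by apply/(measurable_restrictT _ (measurableC mN)); exact: measurable_funTS.
  exists N; split => // x /= gx; apply: contrapT => Nx; apply: gx => _.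
  by rewrite patchE mem_set.
rewrite ge0_integralTE// ge0_integralTE//; apply: ereal_sup_le => _ [h hg <-].
exists h => // x; apply: le_trans (hg x) _; rewrite patchE.
case: ifPn => // xN; apply: contrapT => gf.
by move: xN; rewrite inE; apply; exact: gfN.
Qed.

Lemma cond_exp_ge0 (G : set (set T)) (X Y : T -> \bar R) :
  sigma_algebra setT G -> G `<=` measurable -> (forall x, 0 <= X x) ->
  is_cond_exp P G X Y -> {ae P, forall x, 0 <= Y x}.
Proof.
move=> sG GT X0 [mYG YE]; have mY := measurable_fun_ambient sG GT mYG.
pose A := [set x | Y x < 0].
have GA : G A.
  rewrite -measurable_g_sigmaE// -[X in measurable X]setTI.
  exact: (measurable_lte measurableT (g := cst 0)).
have mA := GT A GA.
have Yabs : \int[P]_(x in A) `|Y x| = 0.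
  apply/eqP; rewrite eq_le integral_ge0// andbT -oppe_ge0.
  have : 0 <= \int[P]_(x in A) Y x by rewrite YE//; exact: integral_ge0.
  rewrite integralE [X in X - _](_ : _ = 0) ?sub0e; last first.
    apply: integral0_eq => x Ax; rewrite funeposE; apply/max_idPr.
    exact: ltW.
  congr (_ <= - _); apply: eq_integral => x; rewrite inE => Ax.
  rewrite funenegE lte0_abs//; apply/max_idPl; rewrite oppe_ge0; exact: ltW.
have : ae_eq P A Y (cst 0).
  by apply/ae_eq_integral_abs => //; exact: measurable_funTS.
apply: filterS => x AY; rewrite leNgt; apply/negP => Yx.
by move: (Yx); rewrite (AY Yx) ltxx.
Qed.

Lemma cond_exp_ge0_version (G : set (set T)) (X Y : T -> \bar R) :
  sigma_algebra setT G -> G `<=` measurable -> (forall x, 0 <= X x) ->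
  is_cond_exp P G X Y -> is_cond_exp P G X (fun x => maxe (Y x) 0).
Proof.
move=> sG GT X0 YX; have Y0 := cond_exp_ge0 sG GT X0 YX.
have [mYG YE] := YX; have mY := measurable_fun_ambient sG GT mYG.
split; first exact: measurable_maxe.
move=> A GA; rewrite -YE//; apply: ae_eq_integral.
- exact: GT.
- by apply: measurable_funTS; exact: measurable_maxe.
- exact: measurable_funTS.
- by apply: filterS Y0 => x Y0 _; apply/max_idPl.
Qed.

End NonnegativeVersion.

(** * Powers of extended reals *)

Section Powers.
Context (R : realType).
Local Open Scope ereal_scope.

Lemma poweR_le2 (p : R) (x y : \bar R) : (0 < p)%R -> 0 <= x -> 0 <= y ->
  (x `^ p <= y `^ p) = (x <= y).
Proof.
move=> p0 x0 y0; apply/idP/idP; last first.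
  by move=> xy; apply: gt0_ler_poweR => //; rewrite ?in_itv/= ?x0 ?y0 ?leey// ltW.
move=> h; have pE z : 0 <= z -> z = (z `^ p) `^ p^-1.
  by move=> z0; rewrite -poweRrM mulfV ?gt_eqF// poweRe1.
rewrite (pE x)// (pE y)//; apply: gt0_ler_poweR => //.
- by rewrite invr_ge0 ltW.
- by rewrite in_itv/= poweR_ge0 leey.
- by rewrite in_itv/= poweR_ge0 leey.
Qed.

Lemma poweR_lt2 (p : R) (x y : \bar R) : (0 < p)%R -> 0 <= x -> 0 <= y ->
  (x `^ p < y `^ p) = (x < y).
Proof. by move=> p0 x0 y0; rewrite !ltNge poweR_le2. Qed.

Lemma lte_mul_pdivr (k l : R) (y : \bar R) : (0 < k)%R ->
  (l%:E < k%:E * y) = ((l / k)%:E < y).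
Proof. by move=> k0; rewrite [in RHS]mulrC EFinM lte_pdivrMl. Qed.

Lemma lt_sqrte_sqr (s : R) (x : \bar R) : (0 <= s)%R -> 0 <= x ->
  (s%:E < sqrte x) = ((s ^+ 2)%:E < x).
Proof.
move=> s0 x0; rewrite !ltNge; congr (~~ _).
have -> : s%:E = sqrte (s ^+ 2)%:E by rewrite /= sqrtr_sqr ger0_norm.
by rewrite lee_sqrt// lee_fin sqr_ge0.
Qed.

End Powers.

(** * The moment inequality *)

Section Main.
Context (R : realType) d (T : measurableType d) (P : probability T R).
Local Open Scope ereal_scope.

Lemma sup_seq_ge0 (g : nat -> T -> R) x : g 0%N x = 0%R -> 0 <= sup_seq g x.
Proof. by move=> g0; apply: ereal_sup_ubound; exists 0%N => //; rewrite g0. Qed.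

Section Nonnegative.
Variables (F : nat -> set (set T)) (f : nat -> T -> R) (V : nat -> T -> \bar R).
Hypotheses (sf : is_supermartingale P F f) (f0 : forall x, f 0%N x = 0%R).
Hypotheses (VE : is_cond_var P F f V) (V0 : forall j x, 0 <= V j x).
Variables (p c : R).

Lemma measurable_sq_fun2 : measurable_fun setT (sq_fun2 V).
Proof.
rewrite (_ : sq_fun2 V = fun x => (\sum_(0 <= j <oo) V j x) `^ 2^-1).
  apply: (measurableT_comp (measurable_poweR _)).
  exact: (measurable_var sf VE V0).
by apply/funext => x; rewrite poweR12_sqrt//; exact: nneseries_ge0.
Qed.

Let K : R := (6 * Num.sqrt c * expR (2^-1 + p / c))%R.

(** The parameters are [a = l / (6 c)], [h = u / a] with
    [3 u = 1 + 2 p / c], and [y2 = (l / K)^2], where [K^2 = 36 c e^(3 u)].  The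
    exponent is then at least
    [u (6 c - 1) - c (u e^(-u))^2 >= 5 c u - c >= 2 p]. *)
Lemma tail_good_lambda (l : R) : (2 <= p)%R -> (1 <= c)%R -> (0 < l)%R ->
  P [set x | (2 * l)%:E < sup_seq f x] <=
  (expR (- (2 * p)))%:E * P [set x | l%:E < sup_seq f x] +
  P [set x | l%:E < (6 * c)%:E * sup_seq (diff_seq f) x] +
  P [set x | l%:E < K%:E * sq_fun2 V x].
Proof.
move=> p2 c1 l0.
have c0 : (0 < c)%R by apply: lt_le_trans c1.
have K0 : (0 < K)%R by rewrite /K !mulr_gt0 ?sqrtr_gt0 ?expR_gt0.
have K2 : (K ^+ 2 = 36 * c * expR (1 + 2 * p / c))%R.
  rewrite /K !exprMn sqr_sqrtr ?(ltW c0)// -expRM_natl.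
  congr (_ * _)%R; last by congr expR; field; rewrite gt_eqF.
  by rewrite -natrX.
pose u := ((2 * p / c + 1) / 3)%R; pose a := (l / (6 * c))%R.
have u0 : (0 < u)%R.
  have p0 : (0 < p)%R by apply: lt_le_trans p2.
  by rewrite /u divr_gt0// addr_gt0// divr_gt0// mulr_gt0.
have a0 : (0 < a)%R by rewrite /a divr_gt0// mulr_gt0.
have -> : [set x | l%:E < (6 * c)%:E * sup_seq (diff_seq f) x] =
    [set x | a%:E < sup_seq (diff_seq f) x].
  by apply/seteqP; split => x /=; rewrite lte_mul_pdivr ?mulr_gt0.
have -> : [set x | l%:E < K%:E * sq_fun2 V x] =
    [set x | ((l / K) ^+ 2)%:E < \sum_(0 <= j <oo) V j x].
  have S0 x : 0 <= \sum_(0 <= j <oo) V j x by exact: nneseries_ge0.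
  by apply/seteqP; split => x /=;
    rewrite lte_mul_pdivr// lt_sqrte_sqr// divr_ge0// ltW.
apply: (tail_sup_seq sf VE V0 f0 l0 (ltW a0) (h := (u / a)%R)).
- rewrite /a ler_pdivrMr ?mulr_gt0// ler_peMr ?(ltW l0)//; lra.
- by rewrite divr_ge0// ltW.
have -> : ((u / a) * a = u)%R by rewrite mulfVK// gt_eqF.
have -> : (u / a * (l - a) = u * (6 * c - 1))%R.
  by rewrite /a; field; rewrite !gt_eqF.
have -> : ((u / a) ^+ 2 * expR u * (l / K) ^+ 2 =
    c * (u * expR (- u)) ^+ 2)%R.
  rewrite [((l / K) ^+ 2)%R]exprMn exprVn K2.
  have -> : (1 + 2 * p / c = u + u + u)%R by rewrite /u; field; rewrite gt_eqF.
  rewrite !expRD expRN /a; field.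
  by rewrite !gt_eqF ?expR_gt0.
have ue : (u * expR (- u) <= 1)%R.
  have : (u <= expR u)%R by apply: le_trans (expR_ge1Dx u); rewrite lerDr.
  by move=> ?; rewrite expRN ler_pdivrMr ?expR_gt0// mul1r.
have ue0 : (0 <= u * expR (- u))%R by rewrite mulr_ge0 ?expR_ge0// ltW.
have : (c * (u * expR (- u)) ^+ 2 <= c * 1)%R.
  by rewrite ler_pM2l// expr_le1.
have : (c * u = (2 * p + c) / 3)%R by rewrite /u; field; rewrite gt_eqF.
have : (u <= u * c)%R by rewrite ler_peMr// ltW.
set X := (c * (u * expR (- u)) ^+ 2)%R.
lra.
Qed.

Lemma moment_sup_le : (2 <= p)%R -> (1 <= c)%R ->
  \int[P]_x (sup_seq f x `^ p) <= (2 * 2 `^ p)%:E *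
    (\int[P]_x (((6 * c)%:E * sup_seq (diff_seq f) x) `^ p) +
     \int[P]_x ((K%:E * sq_fun2 V x) `^ p)).
Proof.
move=> p2 c1.
have p0 : (0 < p)%R by lra.
have c0 : (0 < c)%R by lra.
have K0 : (0 <= K)%R by rewrite /K !mulr_ge0 ?sqrtr_ge0 ?expR_ge0.
have mp (g : T -> \bar R) : measurable_fun setT g ->
    measurable_fun setT (fun x => g x `^ p).
  by move=> mg; exact: (measurableT_comp (measurable_poweR p)).
have d0 x : 0 <= (6 * c)%:E * sup_seq (diff_seq f) x.
  by rewrite mule_ge0// ?sup_seq_ge0// lee_fin mulr_ge0// ltW.
have s0 x : 0 <= K%:E * sq_fun2 V x.
  by rewrite mule_ge0 ?lee_fin ?sqrte_ge0.
have sup0 x : 0 <= sup_seq f x by exact: sup_seq_ge0.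
apply: (@good_lambda _ _ _ P _ _ _ (2 `^ p)%R (expR (- (2 * p)))) => //.
- exact/mp/(measurable_sup sf).
- by apply/mp/measurable_funeM; exact: (measurable_sup_diff sf).
- exact/mp/measurable_funeM/measurable_sq_fun2.
- by move=> x; exact: poweR_ge0.
- by move=> x; exact: poweR_ge0.
- by move=> x; exact: poweR_ge0.
- by have := @ler_powR R 2 (ler1n R 2) _ _ (ltW p0); rewrite powRr0.
- have e2 : (2 <= expR 1 :> R)%R by apply: le_trans (expR_ge1Dx _).
  have h1 : (2 `^ p <= expR p :> R)%R.
    by rewrite -[X in expR X]mul1r expRM ge0_ler_powR ?nnegrE ?expR_ge0// ltW.
  apply: (@le_trans _ _ (expR p * expR (- (2 * p)))%R).
    by rewrite ler_pM2r ?expR_gt0.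
  rewrite -expRD (_ : p + - (2 * p) = - p)%R; last by ring.
  rewrite expRN lef_pV2 ?posrE ?expR_gt0//.
  by apply: (le_trans e2); rewrite ler_expR; lra.
move=> t t0; pose l := (t `^ p^-1)%R.
have l0 : (0 < l)%R by rewrite powR_gt0.
have tl : t%:E = l%:E `^ p.
  by rewrite poweR_EFin -powRrM mulVf ?gt_eqF// powRr1// ltW.
have := tail_good_lambda p2 c1 l0.
have -> : [set x | (2 `^ p * t)%:E < sup_seq f x `^ p] =
    [set x | (2 * l)%:E < sup_seq f x].
  have e2 : (2 `^ p * t)%:E = (2 * l)%:E `^ p.
    by rewrite !EFinM tl poweRM ?lee_fin ?(ltW l0).
  by apply/seteqP; split => x /=; rewrite e2 poweR_lt2// lee_fin mulr_ge0// ltW.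
have lt_set (g : T -> \bar R) : (forall x, 0 <= g x) ->
    [set x | t%:E < g x `^ p] = [set x | l%:E < g x].
  by move=> g0; apply/seteqP; split => x /=; rewrite tl poweR_lt2 // lee_fin ltW.
by rewrite !lt_set.
Qed.

End Nonnegative.
End Main.

(** * From moments to norms *)

Section NormBound.
Context (R : realType) d (T : measurableType d) (P : probability T R).
Local Open Scope ereal_scope.

Lemma Lnorm_poweR_scale (g : T -> \bar R) (k p : R) : (0 <= k)%R -> (0 < p)%R ->
  measurable_fun setT g -> (forall x, 0 <= g x) ->
  \int[P]_x ((k%:E * g x) `^ p) = (k%:E * 'N[P]_p%:E[g]) `^ p.
Proof.
move=> k0 p0 mg g0.
have mp : measurable_fun setT (fun x => g x `^ p).
  exact: (measurableT_comp (measurable_poweR p)).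
rewrite poweRM ?lee_fin ?Lnorm_ge0// poweR_Lnorm ?gt_eqF//.
transitivity (\int[P]_x (k%:E `^ p * g x `^ p)).
  by apply: eq_integral => x _; rewrite poweRM.
rewrite ge0_integralZl ?poweR_ge0//.
  by congr (_ * _); apply: eq_integral => x _; rewrite gee0_abs.
by move=> x _; exact: poweR_ge0.
Qed.

(** Each of [a^p] and [b^p] is at most [(a + b)^p], and [2 * 2 * 2^p <= 4^p]
    because [p >= 2]. *)
Lemma le_Lnorm_sum (X : T -> \bar R) (p : R) (a b : \bar R) :
  (2 <= p)%R -> (forall x, 0 <= X x) -> 0 <= a -> 0 <= b ->
  \int[P]_x (X x `^ p) <= (2 * 2 `^ p)%:E * (a `^ p + b `^ p) ->
  'N[P]_p%:E[X] <= 4%:E * (a + b).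
Proof.
move=> p2 X0 a0 b0 H; have p0 : (0 < p)%R by lra.
rewrite -(poweR_le2 p0) ?mule_ge0 ?adde_ge0 ?lee_fin ?Lnorm_ge0// poweR_Lnorm ?gt_eqF//.
under eq_integral do rewrite gee0_abs//.
apply: (le_trans H); rewrite poweRM ?adde_ge0 ?lee_fin//.
have ab0 : 0 <= a + b by exact: adde_ge0.
apply: (@le_trans _ _ ((2 * 2 `^ p)%:E * (2%:E * (a + b) `^ p))).
  apply: lee_wpmul2l; first by rewrite lee_fin mulr_ge0// powR_ge0.
  rewrite -[2%:E]/((1 + 1)%:E) EFinD ge0_muleDl// mul1e.
  by apply: leeD; rewrite poweR_le2// ?leeDl// leeDr.
rewrite muleA; apply: lee_wpmul2r; first exact: poweR_ge0.
rewrite poweR_EFin -EFinM lee_fin (_ : 4 = 2 * 2)%R; last by ring.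
rewrite powRM// mulrC mulrA ler_wpM2r ?powR_ge0//.
apply: (@le_trans _ _ (2 `^ 2)%R); first by rewrite powR_mulrn.
by rewrite ler_powR// ler1n.
Qed.

(** The constant 48 comes from [4 * 6 c] and from
    [4 K = 24 e^(1/2) sqrt(c) e^(p/c)], with [e^(1/2) <= 2]. *)
Lemma Lnorm_sup_le_nonneg (F : nat -> set (set T)) (f : nat -> T -> R)
    (V : nat -> T -> \bar R) (p c : R) :
  is_supermartingale P F f -> (forall x, f 0%N x = 0%R) ->
  is_cond_var P F f V -> (forall j x, 0 <= V j x) ->
  (2 <= p)%R -> (1 <= c)%R ->
  'N[P]_p%:E[sup_seq f] <=
   48%:E * (c%:E * 'N[P]_p%:E[sup_seq (diff_seq f)] +
           (Num.sqrt c * expR (p / c))%:E * 'N[P]_p%:E[sq_fun2 V]).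
Proof.
move=> sf f0 VE V0 p2 c1; have p0 : (0 < p)%R by lra.
have c0 : (0 <= c)%R by lra.
pose K := (6 * Num.sqrt c * expR (2^-1 + p / c))%R.
have K0 : (0 <= K)%R by rewrite /K !mulr_ge0 ?sqrtr_ge0 ?expR_ge0.
have msq := measurable_sq_fun2 sf VE V0.
have := moment_sup_le sf f0 VE V0 p2 c1.
rewrite !Lnorm_poweR_scale//; last 4 first.
- by apply: mulr_ge0.
- exact: (measurable_sup_diff sf).
- by move=> x; exact: sup_seq_ge0.
- by move=> x; exact: sqrte_ge0.
move=> /le_Lnorm_sum; rewrite -/K => H.
apply: (le_trans (H _ _ _ _)) => //.
- by move=> x; exact: sup_seq_ge0.
- by rewrite mule_ge0// ?Lnorm_ge0// lee_fin mulr_ge0.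
- by rewrite mule_ge0// ?Lnorm_ge0.
have le_coef (k m : R) (y : \bar R) : (0 <= k)%R -> (4 * k <= 48 * m)%R -> 0 <= y ->
    4%:E * (k%:E * y) <= 48%:E * (m%:E * y).
  by move=> k0 km y0; rewrite !muleA -!EFinM; apply: lee_wpmul2r; rewrite ?lee_fin.
rewrite !ge0_muleDr ?mule_ge0 ?Lnorm_ge0 ?lee_fin ?mulr_ge0 ?sqrtr_ge0 ?expR_ge0//.
apply: leeD; apply: le_coef; rewrite ?Lnorm_ge0 ?mulr_ge0//.
  lra.
have eh : (expR 2^-1 <= 2 :> R)%R.
  have := @expR_ge1Dx R (- 2^-1)%R; rewrite expRN => h.
  have : (2^-1 <= (expR 2^-1)^-1 :> R)%R by lra.
  by rewrite lef_pV2 ?posrE ?expR_gt0.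
rewrite /K expRD.
have : (Num.sqrt c * expR (p / c) * expR 2^-1 <= Num.sqrt c * expR (p / c) * 2)%R.
  by rewrite ler_wpM2l// mulr_ge0 ?sqrtr_ge0 ?expR_ge0.
lra.
Qed.

End NormBound.

Theorem theorem8p3 (R : realType) :
  exists A : R, 0 < A /\
  forall (d : measure_display) (T : measurableType d) (P : probability T R)
    (F : nat -> set (set T)) (f : nat -> T -> R) (V : nat -> T -> \bar R)
    (p c : R),
  is_supermartingale P F f ->
  (forall x, f 0%N x = 0) ->
  is_cond_var P F f V ->
  2 <= p -> 1 <= c <= p ->
  ('N[P]_p%:E[sup_seq f] <=
   A%:E * (c%:E * 'N[P]_p%:E[sup_seq (diff_seq f)] +
           (Num.sqrt c * expR (p / c))%:E * 'N[P]_p%:E[sq_fun2 V]))%E.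
Proof.
exists 48; split => // d T P F f V p c sf f0 VE p2 /andP[c1 _].
have [sF FT] : (forall n, sigma_algebra setT (F n)) /\
  (forall n, F n `<=` measurable) by case: sf => -[].
pose V' j x := maxe (V j x) 0%E.
have V'0 j x : (0 <= V' j x)%E by rewrite /V' le_max lexx orbT.
have d20 j x : (0 <= (diff_seq f j.+1 x ^+ 2)%:E)%E by rewrite lee_fin sqr_ge0.
have V'E : is_cond_var P F f V'.
  by move=> j; apply: cond_exp_ge0_version.
apply: (le_trans (Lnorm_sup_le_nonneg sf f0 V'E V'0 p2 c1)).
have k0 : (0 <= (Num.sqrt c * expR (p / c))%:E)%E.
  by rewrite lee_fin mulr_ge0 ?sqrtr_ge0 ?expR_ge0.
apply: lee_wpmul2l => //; apply: leeD => //; apply: lee_wpmul2l => //.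
have p0 : 0 < p by lra.
rewrite -(poweR_le2 p0) ?Lnorm_ge0// !poweR_Lnorm ?gt_eqF//.
apply: ae_ge0_le_integral_right.
- apply: (measurableT_comp (measurable_poweR p)); apply: measurableT_comp => //.
  exact: (measurable_sq_fun2 sf V'E V'0).
- by move=> x; exact: poweR_ge0.
- by move=> x; exact: poweR_ge0.
have : {ae P, forall x, forall j, (0 <= V j x)%E}.
  by apply: ae_foralln => j; exact: (cond_exp_ge0 (sF j) (FT j) (d20 j) (VE j)).
apply: filterS => x Vx; rewrite /sq_fun2 /V'.
by under eq_eseriesr do rewrite (max_idPl _)//.
Qed.
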